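(* Let $\lambda\vdash n$ be a partition and let $\mathbf{x}=(x_i)_{i\in\mathbb{Z}}$ be commuting indeterminates. Then, as an identity of rational functions in $\mathbf{x}$, \[\sum_{T}T_{\mathbf{x}}=\prod_{(i,j)\in\lambda}\frac{1}{h_\lambda(i,j;\mathbf{x})},\] where the sum is over all standard Young tableaux $T$ of shape $\lambda$.
   Context: Partitions are drawn in English notation with matrix coordinates: the box in row $i$ and column $j$ is $(i,j)$. The hook $H_\lambda(i,j)$ is the set of boxes $(i,j')\in\lambda$ with $j'\ge j$ together with the boxes $(i',j)\in\lambda$ with $i'\ge i$, and the $\mathbf{x}$-hook-length is $h_\lambda(i,j;\mathbf{x})=\sum_{(i',j')\in H_\lambda(i,j)}x_{j'-i'}$. For a standard Young tableau $T$ of shape $\lambda\vdash n$ and $k\in[n]$, let $(i_T(k),j_T(k))$ be the box containing $k$, and define \[T_{\mathbf{x}}=\prod_{k=1}^{n}\frac{1}{\sum_{l=1}^{k}x_{j_T(n+1-l)-i_T(n+1-l)}}.\] *)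

(* Defs.v *)
From HB Require Import structures.
From mathcomp Require Import all_boot all_order all_algebra.
Set Implicit Arguments. Unset Strict Implicit. Unset Printing Implicit Defensive.
Import Order.TTheory GRing.Theory Num.Theory.

(* Boxes are 0-indexed pairs (row, column) in English/matrix notation.
   Contents j - i are invariant under shifting both coordinates by 1. *)

Definition is_partition (lam : seq nat) : bool :=
  sorted geq lam && all (fun p => 0 < p) lam.

Definition in_diagram (lam : seq nat) (i j : nat) : bool :=
  (i < size lam) && (j < nth 0 lam i).

Definition content (i j : nat) : int := (j%:Z - i%:Z)%R.

Section Hooks.
Variables (n : nat) (lam : seq nat).

(* boxes of lam (with coordinates < n, which is all of them when lam |- n) *)
Definition box_in (b : 'I_n * 'I_n) : bool := in_diagram lam b.1 b.2.

Definition hook (i j : nat) : {set 'I_n * 'I_n} :=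
  [set b : 'I_n * 'I_n | box_in b &&
     (((b.1 == i :> nat) && (j <= b.2)) || ((b.2 == j :> nat) && (i <= b.1)))].

Definition hook_length {R : nmodType} (x : int -> R) (i j : nat) : R :=
  (\sum_(b in hook i j) x (content b.1 b.2))%R.

(* A standard Young tableau T of shape lam |- n, encoded by the map
   f : 'I_n -> boxes, where f k is the box (i_T(k+1), j_T(k+1)) containing
   the entry k+1.  T is a bijection [n] -> lam, increasing along rows
   and down columns. *)
Definition is_syt (f : {ffun 'I_n -> 'I_n * 'I_n}) : bool :=
  [&& injectiveb f,
      [forall k, box_in (f k)],
      [forall b, box_in b ==> [exists k, f k == b]],
      [forall k, forall l,
         ((f l).1 == (f k).1 :> nat) && ((f l).2 == (f k).2.+1 :> nat) ==> (k < l)]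
    & [forall k, forall l,
         ((f l).2 == (f k).2 :> nat) && ((f l).1 == (f k).1.+1 :> nat) ==> (k < l)]].

(* T_x = prod_{k=1}^n 1 / (sum_{l=1}^k x_{c(T(n+1-l))}); with 0-indexed
   entries, T(n+1-l) is f (n-l), and l ranges over 1..k iff the index
   m = n-l satisfies n-k <= m. *)
Definition Tx {F : fieldType} (x : int -> F) (f : {ffun 'I_n -> 'I_n * 'I_n}) : F :=
  (\prod_(k < n)
     (\sum_(m : 'I_n | (n - k.+1 <= m)%N) x (content (f m).1 (f m).2))^-1)%R.

End Hooks.

(* Main.v *)
Require Import Defs.
From mathcomp Require Import all_boot all_order all_algebra.
From mathcomp Require Import perm zify.
Set Implicit Arguments. Unset Strict Implicit. Unset Printing Implicit Defensive.
Import GRing.Theory.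

(* Pad lam with zeros to n rows and attach to each mu inside lam the beta numbers
   beta_i = mu_i + n - 1 - i.  Choose a with a(k+1) - a(k) = x_(k+1-n), so that sums
   of x over consecutive contents become differences of values of a.  Let N(mu) be
   the determinant of the factorial powers (z_j | a)^(beta_i(mu)) at
   z_j = a(beta_j(lam)), the numerator of a factorial Schur function.  Since
   z (z|a)^k = (z|a)^(k+1) + a(k) (z|a)^k, we get the Pieri rule
     x(lam/mu) N(mu) = sum of N(mu+) over mu+ obtained from mu by adding a box,
   where N(mu+) vanishes unless mu+ is a partition inside lam.  Iterating it from the
   empty partition, the sum over tableaux times N(lam) equals N(0).  Finally N(lam) is
   triangular and N(0) is a Vandermonde determinant, and their ratio is the product
   of the hook lengths.
   N(0) may vanish for the given x, so the identity is first proved for a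
   deformation of x over the rational functions in one variable 'X, then
   specialized at 'X = 0. *)

(** * Factorial Schur determinants: Pieri rule, vanishing, evaluation *)

Section FactorialSchur.
Local Open Scope ring_scope.
Variables (K : comNzRingType) (n : nat) (a : nat -> K).
Implicit Types mu lam : 'I_n -> nat.

Definition beta mu (i : 'I_n) : nat := (mu i + (n - i.+1))%N.

Definition fact_pow (k : nat) (z : K) : K := \prod_(t < k) (z - a t).

(* [fs_det lam mu] is the numerator in the bialternant formula for the factorial Schur
   function of [mu], at the point [j |-> a (beta lam j)]. *)
Definition fs_mx lam mu : 'M[K]_n :=
  \matrix_(i, j) fact_pow (beta mu i) (a (beta lam j)).

Definition fs_det lam mu : K := \det (fs_mx lam mu).

Definition add_box mu (j : 'I_n) : 'I_n -> nat :=
  fun i => (mu i + (i == j))%N.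

Definition beta_sum mu : K := \sum_(i < n) a (beta mu i).

Lemma eq_fs_det lam mu nu : mu =1 nu -> fs_det lam mu = fs_det lam nu.
Proof.
move=> e; congr (\det _); apply/matrixP => i j.
by rewrite !mxE /beta e.
Qed.

Lemma fact_pow0 k t : (t < k)%N -> fact_pow k (a t) = 0.
Proof. by move=> h; rewrite /fact_pow (bigD1 (Ordinal h)) //= subrr mul0r. Qed.

(** In the term of a permutation [s], raising row [j] multiplies the entry at [(j, s j)] by
    [a (beta lam (s j)) - a (beta mu j)]. Summed over [j], this factor no longer depends on [s]. *)
Lemma fs_det_pieri lam mu :
  \sum_(j < n) fs_det lam (add_box mu j) =
  (beta_sum lam - beta_sum mu) * fs_det lam mu.
Proof.
rewrite /fs_det /determinant exchange_big mulr_sumr /=; apply: eq_bigr => s _.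
rewrite -mulr_sumr mulrCA; congr (_ * _).
rewrite /beta_sum [X in (X - _) * _](reindex_inj (@perm_inj _ s)) /= -sumrB mulr_suml.
apply: eq_bigr => i _; rewrite (bigD1 i) //= [in RHS](bigD1 i) //= mulrA.
congr (_ * _).
  by rewrite !mxE /beta /add_box eqxx addn1 addSn /fact_pow big_ord_recr mulrC.
by apply: eq_bigr => k ki; rewrite !mxE /beta /add_box (negPf ki) addn0.
Qed.

(** The new box makes the beta numbers of rows [i] and [j] equal, so the matrix has two equal
    rows. *)
Lemma fs_det_not_partition lam mu (i j : 'I_n) :
  j = i.+1 :> nat -> mu i = mu j -> fs_det lam (add_box mu j) = 0.
Proof.
move=> ji e; have nij : i != j by rewrite -val_eqE /= ji; lia.
rewrite /fs_det (determinant_alternate nij) // => k.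
rewrite !mxE /beta /add_box (negPf nij) eqxx e.
by congr (fact_pow _ _); have := ltn_ord j; lia.
Qed.

(* The rows [<= i] and the columns [>= i] meet in a zero block, too large for any
   permutation to avoid. *)
Lemma fs_det_not_sub lam mu (i : 'I_n) :
  (forall j k : 'I_n, (j <= k)%N -> (lam k <= lam j)%N) ->
  (forall j k : 'I_n, (j <= k)%N -> (mu k <= mu j)%N) ->
  (lam i < mu i)%N -> fs_det lam mu = 0.
Proof.
move=> hl hm hi; rewrite /fs_det /determinant big1 // => s _.
have [k ki si] : exists2 k : 'I_n, (k <= i)%N & (i <= s k)%N.
  case: (boolP [exists k : 'I_n, (k <= i)%N && (i <= s k)%N]) => [/existsP[k]|].
    by case/andP; exists k.
  rewrite negb_exists => /forallP h.
  have : (#|[set s k | k in [set k : 'I_n | (k <= i)%N]]|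
          <= #|[set k : 'I_n | (k < i)%N]|)%N.
    apply: subset_leq_card; apply/subsetP => y /imsetP[k]; rewrite !inE => ki ->.
    by have := h k; rewrite ki /= -ltnNge.
  rewrite card_imset; last exact: perm_inj.
  have card_lt m : (m <= n)%N -> #|[set k : 'I_n | (k < m)%N]| = m.
    move=> mn; rewrite cardsE -sum1_card.
    by rewrite -(big_ord_widen n (fun=> 1%N) mn) sum1_card card_ord.
  have := card_lt i.+1 (ltn_ord i); rewrite (card_lt i (ltnW (ltn_ord i))).
  by move=> ->; rewrite ltnn.
rewrite (bigD1 k) //= mxE fact_pow0 ?mul0r ?mulr0 //.
rewrite /beta; have := hl _ _ si; have := hm _ _ ki.
by have := ltn_ord (s k); have := ltn_ord i; lia.
Qed.

(** For [i < j] we have [beta lam j < beta lam i], so the entry at [(i, j)] contains a zero factor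
    and the matrix is lower triangular. *)
Lemma fs_det_diag lam :
  (forall j k : 'I_n, (j <= k)%N -> (lam k <= lam j)%N) ->
  fs_det lam lam = \prod_(i < n) fact_pow (beta lam i) (a (beta lam i)).
Proof.
move=> hl; rewrite /fs_det det_trig.
  by apply: eq_bigr => i _; rewrite mxE.
apply/is_trig_mxP => i j ij; rewrite mxE fact_pow0 // /beta.
by have := hl _ _ (ltnW ij); have := ltn_ord j; lia.
Qed.

Lemma det_rev (A : 'M[K]_n) :
  \det (\matrix_(i, j) A (rev_ord i) (rev_ord j)) = \det A.
Proof.
pose s : 'S_n := perm (can_inj (@rev_ordK n)).
have -> : \matrix_(i, j) A (rev_ord i) (rev_ord j) = row_perm s (col_perm s A).
  by apply/matrixP => i j; rewrite !mxE !permE.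
rewrite row_permE col_permE !det_mulmx !det_perm odd_permV mulrCA -expr2.
by rewrite sqrr_sign mulr1.
Qed.

(** After reversing rows and columns, row [i] evaluates a monic polynomial [q i] of degree [i]. The
    matrix is thus a unitriangular matrix of coefficients times a Vandermonde matrix. *)
Lemma fs_det0 lam :
  fs_det lam (fun=> 0%N) =
  \prod_(i < n) \prod_(j < n | (i < j)%N) (a (beta lam i) - a (beta lam j)).
Proof.
pose q k : {poly K} := \prod_(0 <= t < k) ('X - (a t)%:P).
have sq k : size (q k) = k.+1 by rewrite /q size_prod_XsubC size_iota subn0.
have mq k : q k \is monic by rewrite monic_prod_XsubC.
rewrite /fs_det -det_rev.
pose z := \row_(j < n) a (beta lam (rev_ord j)).
pose L := \matrix_(i < n, j < n) (q i)`_j.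
have -> : \matrix_(i, j) fs_mx lam (fun=> 0%N) (rev_ord i) (rev_ord j)
          = L *m Vandermonde n z.
  apply/matrixP => i j; rewrite !mxE.
  have -> : beta (fun=> 0%N) (rev_ord i) = i.
    by rewrite /beta /=; have := ltn_ord i; lia.
  set zj := a _; have -> : fact_pow i zj = (q i).[zj].
    rewrite /fact_pow /q big_mkord horner_prod; apply: eq_bigr => t _.
    by rewrite hornerXsubC.
  rewrite (@horner_coef_wide _ n) ?sq //.
  by apply: eq_bigr => k _; rewrite !mxE.
rewrite det_mulmx det_trig; last first.
  apply/is_trig_mxP => i j ij; rewrite mxE nth_default // sq //.
rewrite big1 ?mul1r; last first.
  move=> i _; rewrite mxE; have /monicP := mq i.
  by rewrite /lead_coef sq.
rewrite det_Vandermonde.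
under eq_bigr => i _ do under eq_bigr => j _ do rewrite !mxE.
(* Reversal flips the order in each pair of indices; exchanging the two products restores it, so no
   sign appears. *)
rewrite (exchange_big_dep predT) //=.
rewrite (reindex_inj (can_inj (@rev_ordK n))) /=; apply: eq_bigr => i _.
rewrite (reindex_inj (can_inj (@rev_ordK n))) /=; apply: eq_big => [j|j _].
  by have := ltn_ord i; have := ltn_ord j; lia.
by rewrite !rev_ordK.
Qed.

End FactorialSchur.

Lemma eq_of_leq_sum (I : finType) (f g : I -> nat) :
  (forall i, f i <= g i) -> \sum_i f i = \sum_i g i -> f =1 g.
Proof.
move=> fg e i.
apply/eqP; rewrite eqn_leq fg /=.
have : \sum_(j | j != i) f j <= \sum_(j | j != i) g j by apply: leq_sum.
by move: e; rewrite (bigD1 i) //= [in RHS](bigD1 i) //=; lia.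
Qed.

Lemma sum_tuple_cons (V : nmodType) (T : finType) m (P : pred (m.+1.-tuple T))
    (G : m.+1.-tuple T -> V) :
  (\sum_(w | P w) G w =
  \sum_(j : T) \sum_(w : m.-tuple T | P [tuple of j :: w]) G [tuple of j :: w])%R.
Proof.
rewrite pair_big_dep /=.
rewrite (reindex (fun p : T * m.-tuple T => [tuple of p.1 :: p.2])) //=.
exists (fun w => (thead w, [tuple of behead w])) => [[j w] _|w _] /=.
  by congr (_, _); apply: val_inj.
by rewrite -tuple_eta.
Qed.

(** * Iterating the Pieri rule along words of row indices *)

Section Words.
Local Open Scope ring_scope.
Variables (K : fieldType) (n : nat) (a : nat -> K) (lam : 'I_n -> nat).
Implicit Types (mu : 'I_n -> nat) (w : seq 'I_n).

Definition subpartition mu : bool :=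
  [forall i : 'I_n, forall j : 'I_n, (i <= j)%N ==> (mu j <= mu i)%N] &&
  [forall i, (mu i <= lam i)%N].

Lemma subpartitionP mu :
  reflect ((forall i j : 'I_n, (i <= j)%N -> (mu j <= mu i)%N) /\
           (forall i, (mu i <= lam i)%N))
          (subpartition mu).
Proof.
apply: (iffP andP) => -[h1 h2]; split.
- by move=> i j; move/forallP: h1 => /(_ i) /forallP /(_ j) /implyP.
- exact/forallP.
- by apply/forallP => i; apply/forallP => j; apply/implyP; apply: h1.
- exact/forallP.
Qed.

Lemma eq_subpartition mu nu : mu =1 nu -> subpartition mu = subpartition nu.
Proof.
move=> e; rewrite /subpartition; congr (_ && _); last first.
  by apply: eq_forallb => i; rewrite e.
by apply: eq_forallb => i; apply: eq_forallb => j; rewrite !e.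
Qed.

(* Words of row indices, one letter for each box added to [mu]. *)
Fixpoint yam mu w : bool :=
  if w is j :: w' then subpartition (add_box mu j) && yam (add_box mu j) w'
  else true.

(** Each letter contributes the inverse of the Pieri factor of the shape reached before it. *)
Fixpoint word_weight mu w : K :=
  if w is j :: w' then
    (beta_sum a lam - beta_sum a mu)^-1 * word_weight (add_box mu j) w'
  else 1.

Lemma yamP mu w :
  reflect (forall k, (k < size w)%N ->
             subpartition (fun i => mu i + count_mem i (take k.+1 w))%N)
          (yam mu w).
Proof.
have e0 (nu : 'I_n -> nat) (j : 'I_n) : (fun i => nu i + count_mem i [:: j])%N =1 add_box nu j.
  by move=> i; rewrite /add_box /= addn0 eq_sym.
have eS (nu : 'I_n -> nat) (j : 'I_n) v : (fun i => nu i + count_mem i (j :: v))%N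
       =1 (fun i => add_box nu j i + count_mem i v)%N.
  by move=> i; rewrite /add_box /= addnA [j == i]eq_sym.
elim: w mu => [|j w IH] mu; first by constructor.
have t1 : take 1 (j :: w) = [:: j] by rewrite /= take0.
apply: (iffP andP) => [[h1 /IH h2] [|k] hk|h].
- by rewrite t1 (eq_subpartition (e0 mu j)).
- by rewrite (eq_subpartition (eS mu j (take k.+1 w))); apply: h2.
split; first by have := h 0%N isT; rewrite t1 (eq_subpartition (e0 mu j)).
by apply/IH => k hk; rewrite -(eq_subpartition (eS mu j _)); apply: (h k.+1).
Qed.

Lemma eq_beta_sum mu nu : mu =1 nu -> beta_sum a mu = beta_sum a nu.
Proof. by move=> e; apply: eq_bigr => i _; rewrite /beta e. Qed.

Lemma word_weightE mu w :
  word_weight mu w =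
  \prod_(k < size w) (beta_sum a lam -
     beta_sum a (fun i => mu i + count_mem i (take k w))%N)^-1.
Proof.
elim: w mu => [|j w IH] mu; first by rewrite big_ord0.
rewrite big_ord_recl /= IH; congr (_^-1 * _).
  by congr (_ - _); apply: eq_beta_sum => i /=; rewrite addn0.
apply: eq_bigr => k _; congr (_ - _)^-1; apply: eq_beta_sum => i /=.
by rewrite /add_box addnA [j == i]eq_sym.
Qed.

Hypothesis lam_dec : forall i j : 'I_n, (i <= j)%N -> (lam j <= lam i)%N.
Hypothesis weight_neq0 : forall mu, subpartition mu ->
  (exists i, mu i != lam i) -> beta_sum a lam - beta_sum a mu != 0.

(** Either row [j] is as long as the row above it, and two rows of the matrix coincide, or the new
    shape is still decreasing and must leave [lam]. *)
Lemma fs_det_not_subpartition mu j : subpartition mu ->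
  ~~ subpartition (add_box mu j) -> fs_det a lam (add_box mu j) = 0.
Proof.
move=> /subpartitionP[mu_dec mu_lam] nsub.
have [/existsP[i /andP[/eqP ji /eqP e]]|] :=
  boolP [exists i : 'I_n, (j == i.+1 :> nat) && (mu i == mu j)].
  exact: fs_det_not_partition ji e.
rewrite negb_exists => /forallP hstep.
have add_dec (k l : 'I_n) : (k <= l)%N -> (add_box mu j l <= add_box mu j k)%N.
  rewrite /add_box => kl; have := mu_dec _ _ kl.
  case: (eqVneq l j) => [lj|_]; last by case: (k == j) => /=; lia.
  case: (eqVneq k j) => [kj|kj /=]; first by rewrite kj lj.
  subst l.
  rewrite addn0 addn1 leq_eqVlt => /orP[/eqP e|//]; exfalso.
  have klt : (k < j)%N.
    by rewrite ltn_neqAle kl andbT; apply: contra kj => /eqP/val_inj ->.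
  (* Here [mu] is constant from row [k] to row [j], so rows [j - 1] and [j] have equal length,
     against [hstep]. *)
  have hp : (j.-1 < n)%N by have := ltn_ord j; lia.
  have := hstep (Ordinal hp); rewrite /= prednK ?eqxx /=; last by lia.
  case/eqP; apply/eqP; rewrite eqn_leq (mu_dec (Ordinal hp) j) ?andbT /=; last lia.
  have := mu_dec k (Ordinal hp); by rewrite e; apply; rewrite /=; lia.
have [/existsP[i hi]|] := boolP [exists i, (lam i < add_box mu j i)%N].
  exact: fs_det_not_sub hi.
rewrite negb_exists => /forallP h; case/negP: nsub; apply/subpartitionP; split=> // i.
by rewrite leqNgt.
Qed.

Lemma sum_word_weight m mu : subpartition mu ->
  (\sum_i mu i + m = \sum_i lam i)%N ->
  \sum_(w : m.-tuple 'I_n | yam mu w) word_weight mu w * fs_det a lam lam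
  = fs_det a lam mu.
Proof.
elim: m mu => [|m IH] mu smu hm.
  rewrite (big_pred1 [tuple]) /=; last by move=> w; rewrite (tuple0 w) /= eqxx.
  rewrite mul1r; apply: eq_fs_det => i.
  move: hm; rewrite addn0 => hm.
  by have /subpartitionP[_ mu_lam] := smu; rewrite (eq_of_leq_sum mu_lam hm).
rewrite sum_tuple_cons /=.
(* At least one box remains to be added, so [mu] differs from [lam]. *)
have nz : beta_sum a lam - beta_sum a mu != 0.
  apply: weight_neq0 => //; apply/existsP; apply: contraT.
  rewrite negb_exists => /forallP h.
  have e : (\sum_i mu i = \sum_i lam i)%N.
    by apply: eq_bigr => i _; apply/eqP; rewrite -[_ == _]negbK.
  by move: hm; rewrite e; lia.
apply: (mulfI nz); rewrite -fs_det_pieri mulr_sumr; apply: eq_bigr => j _.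
have [good|bad] := boolP (subpartition (add_box mu j)); last first.
  by rewrite fs_det_not_subpartition // big_pred0 ?mulr0.
have hs : (\sum_i add_box mu j i + m = \sum_i lam i)%N.
  rewrite -hm (bigD1 j) //= [in RHS](bigD1 j) //= /add_box eqxx addn1.
  rewrite (eq_bigr mu) => [|i /negPf ->]; last by rewrite addn0.
  by lia.
rewrite -(IH _ good hs).
rewrite mulr_sumr; apply: eq_bigr => w _.
by rewrite -!mulrA mulVKf.
Qed.

End Words.

(** * Standard tableaux of shape [lam] as words *)

Section Diagram.
Variables (n : nat) (lam : seq nat).
Hypotheses (lam_part : is_partition lam) (lam_size : sumn lam = n).

Lemma nth_part_dec i j : i <= j -> nth 0 lam j <= nth 0 lam i.
Proof.
move=> ij; have /andP[srt _] := lam_part.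
case: (ltnP j (size lam)) => hj; last by rewrite [nth 0 lam j]nth_default.
have tr : transitive geq by move=> p q r /= pq qr; apply: leq_trans qr pq.
by apply: (sorted_leq_nth tr leqnn 0 srt _ _ _ _ ij); rewrite inE // (leq_ltn_trans ij).
Qed.

Lemma size_part : size lam <= n.
Proof.
rewrite -lam_size; have /andP[_] := lam_part.
by elim: (lam) => //= p s IH /andP[p0 /IH]; lia.
Qed.

Lemma sum_part : \sum_(i < n) nth 0 lam i = n.
Proof.
have h m (s : seq nat) : size s <= m -> \sum_(i < m) nth 0 s i = sumn s.
  elim: m s => [|m IH] [|p s] //= hs; first by rewrite big_ord0.
    by rewrite big1 // => i _; rewrite nth_nil.
  by rewrite big_ord_recl /= IH.
by rewrite h ?size_part.
Qed.

Lemma nth_part_le i : nth 0 lam i <= n.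
Proof.
rewrite -lam_size; elim: (lam) i => [|p s IH] [|i] //=; first by lia.
by have := IH i; lia.
Qed.

Lemma in_diagramE i j : in_diagram lam i j = (j < nth 0 lam i).
Proof.
rewrite /in_diagram; case: ltnP => //= h.
by rewrite nth_default.
Qed.

(** With this count, an injective filling of the diagram by [n] entries is onto. *)
Lemma card_boxes : #|[set b : 'I_n * 'I_n | box_in lam b]| = n.
Proof.
transitivity (\sum_(i < n) nth 0 lam i); last exact: sum_part.
rewrite cardsE -sum1_card.
rewrite (eq_bigl (fun b : 'I_n * 'I_n => true && box_in lam b)) //.
rewrite -(pair_big_dep predT (fun i j : 'I_n => box_in lam (i, j)) (fun _ _ => 1)) /=.
apply: eq_bigr => i _; under eq_bigl => j do rewrite /box_in in_diagramE.
rewrite -(big_ord_widen n (fun=> 1)) ?nth_part_le //.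
by rewrite sum1_card card_ord.
Qed.

Definition part_fun (i : 'I_n) : nat := nth 0 lam i.

Lemma part_fun_dec (i j : 'I_n) : i <= j -> part_fun j <= part_fun i.
Proof. exact: nth_part_dec. Qed.

Implicit Types (w : n.-tuple 'I_n) (f : {ffun 'I_n -> 'I_n * 'I_n}).

Lemma count_takeS w i (k : 'I_n) :
  count_mem i (take k.+1 w) = count_mem i (take k w) + (tnth w k == i).
Proof.
rewrite (take_nth (tnth w k)) ?size_tuple // -cats1 count_cat /= addn0.
by rewrite -tnth_nth.
Qed.

Lemma count_take_le w i k l : k <= l ->
  count_mem i (take k w) <= count_mem i (take l w).
Proof.
move=> kl; rewrite -(subnKC kl) takeD count_cat; exact: leq_addr.
Qed.

Lemma count_take_lt w (k : 'I_n) l : k < l ->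
  count_mem (tnth w k) (take k w) < count_mem (tnth w k) (take l w).
Proof.
move=> kl; have := count_take_le w (tnth w k) kl.
by rewrite count_takeS eqxx addn1.
Qed.

(** [l] is the moment at which box [(i, c)] is filled. *)
Lemma count_take_occ w i k c : k <= n -> c < count_mem i (take k w) ->
  exists l : 'I_n, [/\ l < k, tnth w l = i & count_mem i (take l w) = c].
Proof.
elim: k => [|k IH] hk; first by rewrite take0.
rewrite (count_takeS w i (Ordinal hk)) /=.
case: (ltnP c (count_mem i (take k w))) => [hc _|hc].
  by have [l [lk wl cl]] := IH (ltnW hk) hc; exists l; split=> //; lia.
case: (tnth w _ =P i) => [e|_]; last by rewrite addn0 ltnNge hc.
rewrite addn1 ltnS => hc'; exists (Ordinal hk); split=> //.
by apply/eqP; rewrite eqn_leq hc hc'.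
Qed.

Lemma col_proof w (k : 'I_n) : count_mem (tnth w k) (take k w) < n.
Proof.
apply: leq_ltn_trans (count_size _ _) _.
by rewrite size_take size_tuple ltn_ord.
Qed.

(** A letter names a row, and the new box goes to the end of that row: its column is the number of
    earlier occurrences of the letter. *)
Definition syt_of_word w : {ffun 'I_n -> 'I_n * 'I_n} :=
  [ffun k => (tnth w k, Ordinal (col_proof w k))].

Definition word_of_syt f : n.-tuple 'I_n := [tuple (f k).1 | k < n].

Lemma syt_of_wordK w : word_of_syt (syt_of_word w) = w.
Proof. by apply: eq_from_tnth => k; rewrite tnth_mktuple ffunE. Qed.

Lemma is_sytP f :
  reflect [/\ injective f, forall k, box_in lam (f k),
    forall b, box_in lam b -> exists k, f k = b,
    forall k l, (f l).1 = (f k).1 :> nat -> (f l).2 = (f k).2.+1 :> nat -> k < l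
    & forall k l, (f l).2 = (f k).2 :> nat -> (f l).1 = (f k).1.+1 :> nat -> k < l]
    (is_syt lam f).
Proof.
apply: (iffP and5P) => -[h1 h2 h3 h4 h5]; split.
- exact/injectiveP.
- exact/forallP.
- by move=> b hb; move/forallP/(_ b): h3; rewrite hb => /existsP[k /eqP]; exists k.
- move=> k l e1 e2; move/forallP/(_ k)/forallP/(_ l)/implyP: h4; apply.
  by rewrite e1 e2 !eqxx.
- move=> k l e1 e2; move/forallP/(_ k)/forallP/(_ l)/implyP: h5; apply.
  by rewrite e1 e2 !eqxx.
- exact/injectiveP.
- exact/forallP.
- apply/forallP => b; apply/implyP => /h3[k e].
  by apply/existsP; exists k; rewrite e.
- apply/forallP => k; apply/forallP => l; apply/implyP => /andP[/eqP e1 /eqP e2].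
  exact: h4.
- apply/forallP => k; apply/forallP => l; apply/implyP => /andP[/eqP e1 /eqP e2].
  exact: h5.
Qed.

(** By induction on entries, the column of an entry counts the earlier entries of its row. With more
    of them, one would occupy the same box; and the box to the left is filled earlier, so there are
    not fewer. *)
Lemma word_of_sytK f : is_syt lam f -> syt_of_word (word_of_syt f) = f.
Proof.
case/is_sytP => finj fbox fsurj frow _; set w := word_of_syt f.
have wE k : tnth w k = (f k).1 by rewrite tnth_mktuple.
suff col m (k : 'I_n) : k < m -> count_mem (f k).1 (take k w) = (f k).2.
  apply/ffunP => k; rewrite ffunE [RHS]surjective_pairing.
  congr pair; first by rewrite wE.
  by apply: val_inj; rewrite /= wE (col k.+1).
elim: m k => // m IH k km; apply/eqP; rewrite eqn_leq; apply/andP; split.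
  rewrite leqNgt; apply/negP => /(count_take_occ (ltnW (ltn_ord k))).
  case=> l [lk wl cl].
  have := IH l; rewrite -wE wl cl => /(_ (leq_trans lk km)) e.
  suff /finj lk' : f l = f k by rewrite lk' ltnn in lk.
  rewrite [LHS]surjective_pairing [RHS]surjective_pairing -wl wE.
  by congr pair; apply: val_inj.
case E : (val (f k).2) => [//|j].
have jn : j < n by have := ltn_ord (f k).2; rewrite /= in E; lia.
have [|l fl] := fsurj ((f k).1, Ordinal jn).
  have := fbox k; rewrite /box_in !in_diagramE /=.
  by move: E => /= E; rewrite E; lia.
have lk : l < k by apply: frow; rewrite fl.
have := IH l (leq_trans lk km); rewrite fl /= => <-.
by have := @count_take_lt w l k lk; rewrite wE fl.
Qed.

Lemma is_syt_of_word w :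
  is_syt lam (syt_of_word w) = yam part_fun (fun=> 0) w.
Proof.
apply/is_sytP/yamP => [[finj fbox fsurj frow fcol] k|h].
  rewrite size_tuple => kn; apply/subpartitionP.
  have sub i : count_mem i (take k.+1 w) <= part_fun i.
    rewrite leqNgt; apply/negP => /(count_take_occ kn)[l [_ wl cl]].
    by have := fbox l; rewrite ffunE /box_in in_diagramE /= wl cl ltnn.
  split=> [i j|i]; last exact: sub.
  rewrite !add0n leq_eqVlt => /orP[/eqP/val_inj -> //|].
  (* It suffices to compare adjacent rows. *)
  have step (p q : 'I_n) : q = p.+1 :> nat ->
      count_mem q (take k.+1 w) <= count_mem p (take k.+1 w).
    (* The last box of row [q] is in column [c]. The box above it lies in [lam] and is filled
       earlier, so row [p] also has more than [c] boxes. *)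
    move=> qp; case E : (count_mem q (take k.+1 w)) => [//|c].
    have [|l [lk wl cl]] := @count_take_occ w q k.+1 c kn; first by rewrite E.
    have cn : c < n by have := col_proof w l; rewrite wl cl.
    have [|m fm] := fsurj (p, Ordinal cn).
      rewrite /box_in in_diagramE /=; apply: leq_trans (part_fun_dec _) => /=.
        by rewrite -E; apply: sub.
      by rewrite qp.
    have ml : m < l.
      by apply: fcol; rewrite fm !ffunE /= ?wl ?cl.
    move: fm; rewrite ffunE => -[wm cm].
    have mk : m < k.+1 by lia.
    by have := count_take_lt w mk; rewrite wm in cm *; rewrite cm.
  case: j => j jn /=; elim: j jn => // j IH jn ij.
  have jn' : j < n by lia.
  apply: leq_trans (step (Ordinal jn') _ _) _ => //.
  move: ij; rewrite ltnS leq_eqVlt => /orP[/eqP e|ij]; last exact: IH.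
  by have -> : Ordinal jn' = i by apply: val_inj.
have {}h (k : 'I_n) : subpartition part_fun (fun i => count_mem i (take k.+1 w)).
  by apply: h; rewrite size_tuple.
have finj : injective (syt_of_word w).
  have lt (k l : 'I_n) : k < l -> syt_of_word w k <> syt_of_word w l.
    rewrite !ffunE => kl -[wkl cc].
    by have := count_take_lt w kl; rewrite cc wkl ltnn.
  move=> k l e; apply: val_inj; case: (ltngtP k l) => // kl.
    by case: (lt _ _ kl).
  by case: (lt _ _ kl).
have fbox k : box_in lam (syt_of_word w k).
  have /subpartitionP[_ /(_ (tnth w k))] := h k.
  by rewrite ffunE /box_in in_diagramE count_takeS eqxx addn1.
split=> //.
(* Surjectivity follows by counting boxes. *)
- have := card_imset predT finj; rewrite -[X in _ = X]/#|'I_n| card_ord => cf.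
  have : [set syt_of_word w k | k in predT] = [set b | box_in lam b].
    apply/eqP; rewrite eqEcard card_boxes cf leqnn andbT.
    by apply/subsetP => _ /imsetP[k _ ->]; rewrite inE.
  move=> /setP e b hb; have := e b; rewrite inE hb => /imsetP[k _ ->].
  by exists k.
- move=> k l; rewrite !ffunE /= => /val_inj wl cl; rewrite ltnNge.
  apply/negP => lk; have := count_take_le w (tnth w k) lk.
  by rewrite -{1}wl cl ltnn.
(* If the lower box came first, then just after its insertion its row would be longer than the row
   above. *)
move=> k l; rewrite !ffunE /= => cl wl; rewrite ltnNge leq_eqVlt.
apply/negP => /orP[/eqP/val_inj e|lk]; first by move: wl; rewrite e; lia.
have /subpartitionP[/(_ (tnth w k) (tnth w l)) + _] := h l.
rewrite wl => /(_ (leqnSn _)); rewrite !count_takeS eqxx cl.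
have -> : (tnth w l == tnth w k) = false.
  by apply/eqP => e; move: wl; rewrite e; lia.
rewrite addn1 addn0 => /leq_trans /(_ (count_take_le w (tnth w k) (ltnW lk))).
by rewrite ltnn.
Qed.

(** * The tableau sum in terms of the two determinants *)

Section TableauSum.
Local Open Scope ring_scope.
Variables (K : fieldType) (x : int -> K) (a : nat -> K).
(** A row [i] of length [c] has beta number [c + (n - i.+1)], so adding box [(i, c)] raises
    [beta_sum] by the [x]-weight of that box. *)
Hypothesis aP : forall (i : 'I_n) c,
  a (c + (n - i.+1)).+1 - a (c + (n - i.+1))%N = x (content i c).
Hypothesis weight_neq0 : forall mu, subpartition part_fun mu ->
  (exists i, mu i != part_fun i) -> beta_sum a part_fun - beta_sum a mu != 0.

Lemma count_word w : yam part_fun (fun=> 0%N) w ->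
  (fun i => count_mem i w) =1 part_fun.
Proof.
move=> /yamP h i.
have sub j : (count_mem j w <= part_fun j)%N.
  have n0 : (0 < n)%N by apply: leq_trans (ltn_ord j).
  have := h n.-1; rewrite size_tuple prednK // leqnn => /(_ isT).
  by case/subpartitionP => _ /(_ j); rewrite take_oversize ?size_tuple.
have tot : (\sum_j count_mem j w = n)%N.
  rewrite -[RHS](size_tuple w); elim: (tval w) => [|j v IH] /=.
    by rewrite big1.
  rewrite big_split /= IH (bigD1 j) //= eqxx big1 // => k.
  by rewrite eq_sym => /negPf ->.
by apply: eq_of_leq_sum sub _ i; rewrite tot sum_part.
Qed.

(** Each box contributes an increment of [beta_sum], and the increments telescope up to the full
    shape [lam]. *)
Lemma tail_sum w (k : 'I_n) : yam part_fun (fun=> 0%N) w ->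
  \sum_(m < n | (k <= m)%N)
     x (content (syt_of_word w m).1 (syt_of_word w m).2) =
  beta_sum a part_fun - beta_sum a (fun i => count_mem i (take k w)).
Proof.
move=> hw; pose B m := beta_sum a (fun i => count_mem i (take m w)).
have -> : beta_sum a part_fun = B n.
  by apply: eq_beta_sum => i; rewrite take_oversize ?size_tuple // count_word.
have step (m : 'I_n) :
    x (content (syt_of_word w m).1 (syt_of_word w m).2) = B m.+1 - B m.
  rewrite ffunE /= -aP /B /beta_sum -sumrB (bigD1 (tnth w m)) //= big1 ?addr0.
    by rewrite /beta count_takeS eqxx addn1 addSn.
  move=> i im; rewrite /beta count_takeS eq_sym (negPf im) addn0 subrr //.
rewrite (eq_bigr _ (fun m _ => step m)).
rewrite -(big_geq_mkord k n predT (fun m => B m.+1 - B m)).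
by rewrite telescope_sumr // ltnW.
Qed.

Lemma Tx_word w : yam part_fun (fun=> 0%N) w ->
  Tx x (syt_of_word w) = word_weight a part_fun (fun=> 0%N) w.
Proof.
move=> hw; rewrite word_weightE size_tuple /Tx.
(* [Tx] lists its factors by the length of the tail, [word_weight] by the length of the prefix
   before it. *)
rewrite (reindex_inj (can_inj (@rev_ordK n))) /=; apply: eq_bigr => k _.
have -> : (n - (n - k.+1).+1 = k)%N by have := ltn_ord k; lia.
by rewrite tail_sum.
Qed.

Lemma sum_Tx :
  (\sum_(f : {ffun 'I_n -> 'I_n * 'I_n} | is_syt lam f) Tx x f) * fs_det a part_fun part_fun =
  fs_det a part_fun (fun=> 0%N).
Proof.
have sub0 : subpartition part_fun (fun=> 0%N) by apply/subpartitionP.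
have size0 : (\sum_(i < n) 0 + n = \sum_i part_fun i)%N.
  by rewrite big1 // sum_part.
rewrite (reindex_onto syt_of_word word_of_syt) /=; last exact: word_of_sytK.
rewrite mulr_suml -(sum_word_weight part_fun_dec weight_neq0 sub0 size0).
apply: eq_big => w; first by rewrite syt_of_wordK eqxx andbT is_syt_of_word.
by rewrite syt_of_wordK eqxx andbT is_syt_of_word => /Tx_word ->.
Qed.

End TableauSum.

(** * Column lengths, beta numbers and the hook product *)

Definition conj_part (c : nat) : nat := find (fun p => p <= c) lam.

Lemma conj_partP c i : (c < nth 0 lam i) = (i < conj_part c).
Proof.
apply/idP/idP => [h|/(before_find 0)/negbT]; last by rewrite -ltnNge.
rewrite ltnNge; apply/negP => hi.
have : nth 0 lam (conj_part c) <= c.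
  (* If every row is longer than [c], then [conj_part c] is [size lam], where [nth] returns its
     default [0]. *)
  have [hs|hs] := boolP (has (fun p => p <= c) lam); first exact: (nth_find 0 hs).
  by rewrite nth_default // leqNgt -has_find.
by have := nth_part_dec hi; lia.
Qed.

Lemma conj_part_le c : conj_part c <= n.
Proof. exact: leq_trans (find_size _ _) size_part. Qed.

(* The numbers below the beta number of row [i] are the beta numbers of the rows
   below it and the numbers [c + (n - conj_part c)] for the columns [c] of row [i]. *)
Lemma iota_beta (i : 'I_n) :
  perm_eq (iota 0 (beta part_fun i))
    ([seq beta part_fun j | j : 'I_n <- enum 'I_n & i < j] ++
     [seq c + (n - conj_part c) | c <- iota 0 (part_fun i)]).
Proof.
(* The number attached to column [c] is never a beta number; it lies below that of row [j] exactly
   when box [(j, c)] is in the diagram. *)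
have gap (j : 'I_n) c : if c < part_fun j
    then c + (n - conj_part c) < beta part_fun j
    else beta part_fun j < c + (n - conj_part c).
  have := conj_part_le c; have := ltn_ord j; have := conj_partP c j.
  by rewrite -/(part_fun j) /beta; case: ltnP => ? /esym ?; lia.
have beta_lt (j k : 'I_n) : j < k -> beta part_fun k < beta part_fun j.
  move=> jk; have := part_fun_dec (ltnW jk); have := ltn_ord k.
  by rewrite /beta; lia.
set s := _ ++ _.
have us : uniq s.
  have mono b b' : b < b' -> conj_part b' <= conj_part b.
    move=> bb; case E : (conj_part b') => [//|m].
    by rewrite -conj_partP; have := conj_partP b' m; rewrite E ltnSn; lia.
  rewrite cat_uniq; apply/and3P; split.
  - rewrite map_inj_in_uniq; first exact: filter_uniq (enum_uniq _).
    move=> j k _ _ e; apply: val_inj.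
    by case: (ltngtP j k) => // /beta_lt; rewrite e ltnn.
  - apply/hasPn => _ /mapP[c _ ->]; apply/mapP => -[j _ e].
    by have := gap j c; case: ifP => _; rewrite e ltnn.
  rewrite map_inj_in_uniq; first exact: iota_uniq.
  move=> c d _ _ e; have := mono c d; have := mono d c.
  by have := conj_part_le c; have := conj_part_le d; lia.
have sub : {subset s <= iota 0 (beta part_fun i)}.
  move=> t; rewrite mem_cat mem_iota add0n /= => /orP[|].
    by case/mapP=> j; rewrite mem_filter => /andP[/beta_lt ij _] ->.
  by case/mapP=> c; rewrite mem_iota /= => ci ->; have := gap i c; rewrite ci.
rewrite perm_sym; apply: uniq_perm => //; first exact: iota_uniq.
(* Since [s] is free of repetitions and contained in the interval, comparing lengths suffices. *)
apply: (uniq_min_size us sub _).2.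
rewrite size_iota size_cat !size_map size_iota /beta addnC leq_add2r.
rewrite size_filter -(count_map _ (fun j => i < j)) val_enum_ord.
rewrite -[X in iota 0 X](subnKC (ltn_ord i)) iotaD count_cat add0n.
have -> : count (fun j => i < j) (iota i.+1 (n - i.+1)) = n - i.+1.
  rewrite -[RHS](size_iota i.+1); apply/eqP; rewrite -all_count; apply/allP => j.
  by rewrite mem_iota => /andP[].
exact: leq_addl.
Qed.

Section HookProduct.
Local Open Scope ring_scope.
Variables (K : fieldType) (x : int -> K) (a : nat -> K).
Hypothesis aP : forall (i : 'I_n) c,
  a (c + (n - i.+1)).+1 - a (c + (n - i.+1))%N = x (content i c).

Lemma sum_ord_range (G : nat -> K) (p q : nat) : (q <= n)%N ->
  \sum_(j < n | (p <= j < q)%N) G j = \sum_(p <= j < q) G j.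
Proof.
by move=> qn; rewrite big_geq_mkord (big_ord_widen_cond n (fun j => p <= j)%N).
Qed.

(** The arm with its corner telescopes from [c + (n - i.+1)] up to the beta number of row [i]; the
    leg telescopes from the same value down to [c + (n - conj_part c)]. *)
Lemma hook_lengthE (i c : 'I_n) : box_in lam (i, c) ->
  hook_length n lam x i c =
  a (beta part_fun i) - a (c + (n - conj_part c))%N.
Proof.
rewrite /box_in in_diagramE /= => ci.
have i_lt : (i < conj_part c)%N by rewrite -conj_partP.
rewrite /hook_length (bigID (fun b : 'I_n * 'I_n => b.1 == i)) /=.
have -> : \sum_(b in hook n lam i c | b.1 == i) x (content b.1 b.2) =
    a (beta part_fun i) - a (c + (n - i.+1))%N.
  rewrite (reindex_onto (fun j => (i, j)) snd) /=; last by case=> k j /= /andP[_ /eqP ->].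
  rewrite (eq_bigl (fun j : 'I_n => (c <= j < part_fun i)%N)) => [|j].
    rewrite (sum_ord_range (fun j => x (content i j))) ?nth_part_le //.
    rewrite (telescope_sumr_eq (fun j => a (j + (n - i.+1))%N)) //; first exact: ltnW.
    by move=> j _; rewrite -aP addSn.
  rewrite inE /box_in in_diagramE /= !eqxx /= !andbT /part_fun leqnn andbT.
  have [->|_] := eqVneq (j : nat) c; first by rewrite leqnn andbT.
  by rewrite orbF andbC.
have -> : \sum_(b in hook n lam i c | b.1 != i) x (content b.1 b.2) =
    a (c + (n - i.+1))%N - a (c + (n - conj_part c))%N.
  rewrite (reindex_onto (fun k => (k, c)) fst) /=; last first.
    case=> k j /= /andP[]; rewrite inE /= => /andP[_ /orP[/andP[/eqP/val_inj -> _]|]].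
      by rewrite eqxx.
    by case/andP=> /eqP/val_inj ->.
  rewrite (eq_bigl (fun k : 'I_n => (i.+1 <= k < conj_part c)%N)) => [|k].
    rewrite (sum_ord_range (fun k => x (content k c))) ?conj_part_le //.
    (* Contents decrease down a column, hence the sign. *)
    rewrite (telescope_sumr_eq (fun k => - a (c + (n - k))%N)) //.
      by rewrite opprK addrC.
    move=> k /andP[_ kc]; have kn := leq_trans kc (conj_part_le c).
    have := aP (Ordinal kn) c; rewrite /= => <-; rewrite opprK [RHS]addrC.
    by congr (a _ - _); lia.
  rewrite inE /box_in in_diagramE /= !eqxx /= !andbT -conj_partP leqnn andbT.
  by rewrite -val_eqE /=; case: (ltnP c _) => /= _; case: (ltngtP k i).
by rewrite addrA subrK.
Qed.

(** By [iota_beta], the diagonal entry of row [i] splits into the Vandermonde factors of [i] with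
    the lower rows and the hook lengths of row [i]. *)
Lemma fs_det_hooks :
  fs_det a part_fun part_fun = fs_det a part_fun (fun=> 0%N) *
  \prod_(b : 'I_n * 'I_n | box_in lam b) hook_length n lam x b.1 b.2.
Proof.
rewrite fs_det_diag; last exact: part_fun_dec.
rewrite fs_det0 -(pair_big_dep predT (fun i c : 'I_n => box_in lam (i, c))
  (fun i c => hook_length n lam x i c)) /= -big_split /=.
apply: eq_bigr => i _; rewrite /fact_pow.
rewrite -(big_mkord predT (fun t => a (beta part_fun i) - a t)).
rewrite /index_iota subn0 (perm_big _ (iota_beta i)) big_cat /= !big_map.
congr (_ * _); first by rewrite big_filter big_enum_cond.
rewrite -{1}[part_fun i]subn0 -/(index_iota 0 (part_fun i)) big_mkord.
rewrite (big_ord_widen n (fun c => a (beta part_fun i) - a (c + (n - conj_part c))%N));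
  last exact: nth_part_le.
apply: eq_big => [c|c ci]; first by rewrite /box_in in_diagramE.
by rewrite hook_lengthE // /box_in in_diagramE.
Qed.

End HookProduct.
End Diagram.

Local Notation "p %:F" := (@tofrac _ p) : ring_scope.

(** * The identity for a deformation of [x] over the rational functions *)

Section Generic.
Local Open Scope ring_scope.
Variables (n : nat) (lam : seq nat).
Hypotheses (lam_part : is_partition lam) (lam_size : sumn lam = n).
Local Notation lamf := (@part_fun n lam).

Lemma beta_part_lt (i j : 'I_n) : (i < j)%N ->
  (beta lamf j < beta lamf i)%N.
Proof.
move=> ij; have := part_fun_dec lam_part (ltnW ij); have := ltn_ord j.
by rewrite /beta; lia.
Qed.

Lemma sum_Tx_generic (K : fieldType) (x : int -> K) (a : nat -> K) :
  (forall (i : 'I_n) c,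
    a (c + (n - i.+1)).+1 - a (c + (n - i.+1))%N = x (content i c)) ->
  (forall mu : 'I_n -> nat, subpartition lamf mu ->
    (exists i, mu i != lamf i) ->
    beta_sum a lamf - beta_sum a mu != 0) ->
  (forall i j : 'I_n, (i < j)%N ->
    a (beta lamf i) != a (beta lamf j)) ->
  \sum_(f : {ffun 'I_n -> 'I_n * 'I_n} | is_syt lam f) Tx x f =
  \prod_(b : 'I_n * 'I_n | box_in lam b) (hook_length n lam x b.1 b.2)^-1.
Proof.
move=> aP weight_neq0 a_inj.
set H := \prod_(b | _) _; set S := \sum_(f | _) _.
pose hk := \prod_(b : 'I_n * 'I_n | box_in lam b) hook_length n lam x b.1 b.2.
have N0 : fs_det a lamf (fun=> 0%N) != 0.
  rewrite fs_det0; apply/prodf_neq0 => i _; apply/prodf_neq0 => j ij.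
  by rewrite subr_eq0 a_inj.
(* Cancelling the nonzero determinant of the empty shape gives this, and it shows in turn that no
   hook length is zero. *)
have SH : S * hk = 1.
  apply: (mulfI N0); rewrite mulr1 mulrCA -(fs_det_hooks lam_part lam_size aP).
  exact: sum_Tx.
have hk0 : hk != 0.
  by apply: contra_eq_neq SH => ->; rewrite mulr0 eq_sym oner_neq0.
by apply: (mulIf hk0); rewrite SH /H prodfV mulVf.
Qed.

Variables (F : fieldType) (x : int -> F).

(* A deformation of [x] for which no difference of beta numbers vanishes; the
   exponents are positive on the contents that occur. *)
Definition deform (c : int) : {poly F} := (x c)%:P + 'X^(absz (c + n%:Z)).

(** This is the sequence [a] for the deformed variables. As [content n t.+1] is [t + 1 - n], its
    deformation terms are ['X + ... + 'X^k]. *)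
Definition deform_sum (k : nat) : {poly F} :=
  \sum_(t < k) deform (content n t.+1).

Lemma coef_deform_sum k e : (0 < e)%N -> (deform_sum k)`_e = (e <= k)%:R.
Proof.
move=> e0; elim: k => [|k IH].
  by rewrite /deform_sum big_ord0 coef0; case: e e0.
rewrite /deform_sum big_ord_recr /= coefD -/(deform_sum k) IH /deform coefD coefC.
rewrite coefXn /content subrK /= eqn0Ngt e0 add0r -natrD.
by congr (_%:R); case: (ltngtP e k.+1) => [|//|->]; lia.
Qed.

Lemma deform_sum_step (i : 'I_n) c :
  deform_sum (c + (n - i.+1)).+1 - deform_sum (c + (n - i.+1)) =
  deform (content i c).
Proof.
rewrite /deform_sum big_ord_recr /= addrAC subrr add0r /content; congr deform.
by have := ltn_ord i; lia.
Qed.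

(** Let [i] be the first row where [mu] and [lam] differ. The coefficient of degree [beta lamf i] is
    1: earlier rows cancel, and later rows have smaller beta numbers. *)
Lemma deform_weight_neq0 (mu : 'I_n -> nat) :
  subpartition lamf mu -> (exists i, mu i != lamf i) ->
  \sum_i (deform_sum (beta lamf i) - deform_sum (beta mu i)) != 0.
Proof.
case/subpartitionP=> mu_dec mu_lam [i0 hi0].
case: (@arg_minnP _ i0 (fun i => mu i != lamf i) val hi0) => i ne imin.
have lt_i : (mu i < lamf i)%N by rewrite ltn_neqAle ne mu_lam.
pose e := beta lamf i.
have e0 : (0 < e)%N by rewrite /e /beta; lia.
suff : (\sum_i (deform_sum (beta lamf i)
                 - deform_sum (beta mu i)))`_e = 1.
  by apply: contra_eq_neq => ->; rewrite coef0 eq_sym oner_neq0.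
rewrite coef_sum (bigD1 i) //= coefB !coef_deform_sum // leqnn.
have -> : (e <= beta mu i)%N = false by rewrite /e /beta; lia.
rewrite subr0 big1 ?addr0 // => j ji; rewrite coefB !coef_deform_sum //.
have [ij|] := ltnP i j.
  have lt_e := beta_part_lt ij.
  have le_j : (beta mu j <= beta lamf j)%N by rewrite leq_add2r.
  by rewrite !(leqNgt e) lt_e (leq_ltn_trans le_j lt_e) subrr.
rewrite leq_eqVlt => /orP[/eqP/val_inj e_ji|lt_ji]; first by rewrite e_ji eqxx in ji.
have -> : beta mu j = beta lamf j; last by rewrite subrr.
rewrite /beta; congr addn; apply/eqP; apply: contraTT lt_ji => h.
by rewrite -leqNgt imin.
Qed.

Lemma sum_Tx_deform :
  \sum_(f : {ffun 'I_n -> 'I_n * 'I_n} | is_syt lam f) Tx (fun c => (deform c)%:F) f =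
  \prod_(b : 'I_n * 'I_n | box_in lam b)
     (hook_length n lam (fun c => (deform c)%:F) b.1 b.2)^-1.
Proof.
apply: (@sum_Tx_generic _ _ (fun k => (deform_sum k)%:F)).
- by move=> i c; rewrite /= -tofracB deform_sum_step.
- move=> mu smu nmu; rewrite /beta_sum -sumrB /=.
  under eq_bigr do rewrite -tofracB.
  by rewrite -rmorph_sum tofrac_eq0; apply: deform_weight_neq0.
move=> i j ij; rewrite /= tofrac_eq; have lt_ij := beta_part_lt ij.
apply/eqP => /(congr1 (fun p : {poly F} => p`_(beta lamf i))).
have e0 := leq_ltn_trans (leq0n _) lt_ij.
rewrite !coef_deform_sum // leqnn leqNgt lt_ij /=.
by move/eqP; rewrite oner_eq0.
Qed.

End Generic.

(** * Specialization at ['X = 0] *)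

Section Specialization.
Local Open Scope ring_scope.
Variable F : fieldType.
Implicit Types (u : {fraction {poly F}}) (v : F).

(** Evaluation at 0 is defined only for fractions regular there, so it is expressed as a relation;
    [specializes_fun] shows that the value is unique. *)
Definition specializes u v : Prop :=
  exists p q : {poly F},
    [/\ q.[0] != 0, u = p%:F / q%:F & v = p.[0] / q.[0]].

Lemma tofrac_neq0 (q : {poly F}) : q.[0] != 0 -> q%:F != 0.
Proof. by rewrite tofrac_eq0; apply: contraNneq => ->; rewrite horner0. Qed.

Lemma specializes_fun u v v' : specializes u v -> specializes u v' -> v = v'.
Proof.
case=> p [q [q0 -> ->]] [p' [q' [q0' + ->]]].
move/eqP; rewrite eqr_div ?tofrac_neq0 // -!tofracM tofrac_eq => /eqP e.
by apply/eqP; rewrite eqr_div // -!hornerM e.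
Qed.

Lemma specializes_tofrac (p : {poly F}) : specializes (p%:F) p.[0].
Proof. by exists p, 1; rewrite tofrac1 hornerC !divr1 oner_neq0. Qed.

Lemma specializesD u v u' v' :
  specializes u v -> specializes u' v' -> specializes (u + u') (v + v').
Proof.
case=> p [q [q0 -> ->]] [p' [q' [q0' -> ->]]].
exists (p * q' + p' * q), (q * q'); split.
- by rewrite hornerM mulf_neq0.
- by rewrite tofracD !tofracM addf_div ?tofrac_neq0.
by rewrite hornerD !hornerM addf_div.
Qed.

Lemma specializesM u v u' v' :
  specializes u v -> specializes u' v' -> specializes (u * u') (v * v').
Proof.
case=> p [q [q0 -> ->]] [p' [q' [q0' -> ->]]].
exists (p * p'), (q * q'); split.
- by rewrite hornerM mulf_neq0.
- by rewrite !tofracM mulf_div.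
by rewrite !hornerM mulf_div.
Qed.

(** A nonzero value means that the numerator does not vanish at 0 and may become the denominator. *)
Lemma specializesV u v : v != 0 -> specializes u v -> specializes u^-1 v^-1.
Proof.
move=> v0 [p [q [q0 -> e]]]; exists q, p; rewrite e !invf_div; split=> //.
by apply: contraNneq v0 => p0; rewrite e p0 mul0r.
Qed.

Lemma specializes_sum (I : finType) (P : pred I) (G : I -> {fraction {poly F}}) H :
  (forall i, P i -> specializes (G i) (H i)) ->
  specializes (\sum_(i | P i) G i) (\sum_(i | P i) H i).
Proof.
move=> GH; apply: (big_ind2 specializes) => //.
- by have := specializes_tofrac 0; rewrite tofrac0 horner0.
- exact: specializesD.
Qed.

Lemma specializes_prod (I : finType) (P : pred I) (G : I -> {fraction {poly F}}) H :
  (forall i, P i -> specializes (G i) (H i)) ->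
  specializes (\prod_(i | P i) G i) (\prod_(i | P i) H i).
Proof.
move=> GH; apply: (big_ind2 specializes) => //.
- by have := specializes_tofrac 1; rewrite tofrac1 hornerC.
- exact: specializesM.
Qed.

Lemma specializes_deform n (x : int -> F) (i c : 'I_n) :
  specializes ((deform n x (content i c))%:F) (x (content i c)).
Proof.
have := specializes_tofrac (deform n x (content i c)).
rewrite hornerD hornerC hornerXn expr0n.
have -> : (absz (content i c + n%:Z) == 0%N) = false.
  by rewrite /content; have := ltn_ord i; lia.
by rewrite addr0.
Qed.

End Specialization.

Unset Implicit Arguments.

(** The variables take values in a field; [Hhook] and [Hden] say that every denominator of the
    rational identity is nonzero at these values. *)
Theorem theorem3p6 (F : fieldType) (n : nat) (lam : seq nat)
  (Hpart : is_partition lam) (Hsize : sumn lam = n) (x : int -> F)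
  (Hhook : forall i j, in_diagram lam i j -> hook_length n lam x i j != 0%R)
  (Hden : forall f : {ffun 'I_n -> 'I_n * 'I_n}, is_syt lam f ->
     forall k : 'I_n,
       (\sum_(m : 'I_n | (n - k.+1 <= m)%N) x (content (f m).1 (f m).2))%R != 0%R) :
  (\sum_(f : {ffun 'I_n -> 'I_n * 'I_n} | is_syt lam f) Tx x f)%R =
  (\prod_(b : 'I_n * 'I_n | box_in lam b) (hook_length n lam x b.1 b.2)^-1)%R.
Proof.
have spec_x (b : 'I_n * 'I_n) :
    specializes ((deform n x (content b.1 b.2))%:F%R) (x (content b.1 b.2)).
  exact: specializes_deform.
have spec_hooks : specializes
    (\prod_(b : 'I_n * 'I_n | box_in lam b)
        (hook_length n lam (fun c => (deform n x c)%:F%R) b.1 b.2)^-1)%R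
    (\prod_(b : 'I_n * 'I_n | box_in lam b) (hook_length n lam x b.1 b.2)^-1)%R.
  apply: specializes_prod => b hb; apply: specializesV; first exact: Hhook.
  exact: specializes_sum.
(* Both sides are values at 0 of one and the same fraction. *)
apply: specializes_fun spec_hooks; rewrite -sum_Tx_deform //.
apply: specializes_sum => f hf; apply: specializes_prod => k _.
apply: specializesV; first exact: Hden.
exact: specializes_sum.
Qed.
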